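(* Let $\mathscr{H}$ be a complex Hilbert space and let $T,S\in\mathbb{B}(\mathscr{H})$ with $m(S)>0$. Then there exists a unique $\gamma\in\mathbb{C}$ such that $$\big\|(T+\gamma S)+\lambda S\big\|^2\ge\big\|T+\gamma S\big\|^2+|\lambda|^2m^2(S)\qquad\text{for all }\lambda\in\mathbb{C}.$$
   Context: Hilbert spaces are nonzero. $\mathbb{B}(\mathscr{H})$ is the algebra of bounded linear operators on $\mathscr{H}$ with the operator norm. The minimum modulus of $S$ is $m(S)=\inf\{\|S\xi\|:\xi\in\mathscr{H},\ \|\xi\|=1\}$, and $m^2(S)=(m(S))^2$. *)

(* Defs.v *)
From HB Require Import structures.
From mathcomp Require Import all_boot all_order all_algebra.
From mathcomp Require Import complex.
From mathcomp Require Import boolp classical_sets reals topology normedtype.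

Set Implicit Arguments.
Unset Strict Implicit.
Unset Printing Implicit Defensive.

Import Order.TTheory GRing.Theory Num.Theory.
Import numFieldNormedType.Exports.

Local Open Scope classical_set_scope.
Local Open Scope complex_scope.
Local Open Scope ring_scope.

(* The inner product is linear in its first argument and conjugate-linear in
   the second.  The zero space is not excluded here. *)
HB.mixin Record CompleteNormedModule_isHilbert (R : realType) (H : Type)
    of CompleteNormedModule R[i] H := {
  inner : {dot H for @Num.conj R[i]};
  sqr_norm_inner : forall x : H, `|x| ^+ 2 = inner x x
}.

#[short(type="complexHilbertType")]
HB.structure Definition ComplexHilbert (R : realType) :=
  {H of CompleteNormedModule R[i] H & CompleteNormedModule_isHilbert R H}.

(* Norms over R[i] take values in R[i]; [rnorm] is the same norm with values
   in R.  It applies both to vectors and to complex scalars. *)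
Definition rnorm (R : realType) (V : normedZmodType R[i]) (x : V) : R :=
  complex.Re `|x|.

Definition bounded_operator (R : realType) (H : complexHilbertType R)
    (A : H -> H) : Prop :=
  exists M : R, forall x : H, rnorm (A x) <= M * rnorm x.

(* Meaningful for bounded A only: [sup] of an unbounded set is 0. *)
Definition opnorm (R : realType) (H : complexHilbertType R) (A : H -> H) : R :=
  sup [set rnorm (A x) | x in [set x : H | rnorm x <= 1]].

(* Meaningful for H nonzero only: [inf] of the empty set is 0. *)
Definition minmod (R : realType) (H : complexHilbertType R) (A : H -> H) : R :=
  inf [set rnorm (A x) | x in [set x : H | rnorm x = 1]].

(* Main.v *)
Require Import Defs.
From mathcomp Require Import all_boot all_order all_algebra.
From mathcomp Require Import complex.
From mathcomp Require Import boolp classical_sets reals topology normedtype.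
From mathcomp Require Import ring lra.

(** The function [F z = opnorm (T + z S) ^ 2] on the complex plane is strongly
convex with modulus [c = minmod S ^ 2].  Indeed, for a fixed unit vector [x], the
Hilbert space identity
  [|(1-t)u + tv|^2 = (1-t)|u|^2 + t|v|^2 - t(1-t)|u-v|^2]
applied to [u = (T + z S) x] and [v = (T + w S) x], for which
[u - v = (z - w) S x] has norm at least [|z - w| minmod S], gives the
strong-convexity inequality for [z |-> |(T + z S) x|^2]; it survives the
supremum over unit vectors ([pencil_strongly_convex]).

The conclusion is then a property of strongly convex functions.  If [F] has a
minimum at [z], dividing the strong-convexity inequality between [z] and [w] by
[t] and letting [t] tend to 0 gives [F z + c |z - w|^2 <= F w]
([strongly_convex_growth]); this is the claimed inequality.  Conversely, if the
inequality holds at [w], taking it at the minimizer [z] gives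
[F w + c |z - w|^2 <= F z <= F w], so [w = z].

A minimum exists ([strongly_convex_minimizer]) because [F] is bounded below by 0
and lower semicontinuous, while strong convexity at midpoints forces the
sublevel sets [F <= inf F + c d^2 / 4] to shrink to a point as [d] tends to
0. *)

Import Order.TTheory GRing.Theory Num.Theory.

Local Open Scope classical_set_scope.
Local Open Scope complex_scope.
Local Open Scope ring_scope.

(** * The real-valued norm *)

Section RealValuedNorm.
Context {R : realType}.

Lemma rnormE {V : normedZmodType R[i]} (x : V) : (rnorm x)%:C = `|x|.
Proof. by rewrite /rnorm RRe_real // normr_real. Qed.

Lemma rnorm_ge0 {V : normedZmodType R[i]} (x : V) : 0 <= rnorm x.
Proof. by rewrite -lecR rnormE normr_ge0. Qed.

Lemma rnorm_triangle {V : normedZmodType R[i]} (x y : V) :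
  rnorm (x + y) <= rnorm x + rnorm y.
Proof. by rewrite -lecR rmorphD /= !rnormE ler_normD. Qed.

Lemma rnorm_eq0 {V : normedZmodType R[i]} (x : V) : rnorm x = 0 -> x = 0.
Proof. by move=> h; apply/normr0_eq0; rewrite -rnormE h. Qed.

Lemma rnormZ {V : normedModType R[i]} (a : R[i]) (x : V) :
  rnorm (a *: x) = rnorm a * rnorm x.
Proof.
have /(congr1 (@complex.Re R)) := rnormE (a *: x).
by rewrite /= normrZ -!rnormE -rmorphM.
Qed.

Lemma rnormC_def (z : R[i]) :
  rnorm z = Num.sqrt (complex.Re z ^+ 2 + complex.Im z ^+ 2).
Proof. by rewrite /rnorm normc_def. Qed.

Lemma rnormRC (t : R) : rnorm t%:C = `|t|.
Proof. by rewrite rnormC_def /= expr0n addr0 sqrtr_sqr. Qed.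

Lemma ler_Re_rnorm (z : R[i]) : `|complex.Re z| <= rnorm z.
Proof.
by rewrite rnormC_def -sqrtr_sqr ler_sqrt ?addr_ge0 ?sqr_ge0 // lerDl sqr_ge0.
Qed.

Lemma ler_Im_rnorm (z : R[i]) : `|complex.Im z| <= rnorm z.
Proof.
by rewrite rnormC_def -sqrtr_sqr ler_sqrt ?addr_ge0 ?sqr_ge0 // lerDr sqr_ge0.
Qed.

Lemma rnorm_le_ReIm (z : R[i]) : rnorm z <= `|complex.Re z| + `|complex.Im z|.
Proof.
rewrite rnormC_def -[leRHS]ger0_norm ?addr_ge0 // -sqrtr_sqr ler_sqrt ?sqr_ge0 //.
rewrite -[_ ^+ 2 in leLHS]real_normK ?num_real //.
rewrite -[_ ^+ 2 in X in _ + X <= _]real_normK ?num_real //.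
have := normr_ge0 (complex.Re z); have := normr_ge0 (complex.Im z); nra.
Qed.

End RealValuedNorm.

(** * Strongly convex functions on the complex plane *)

Section StronglyConvex.
Context {R : realType}.

(** [F] is strongly convex with modulus [c], normalized without the usual factor
1/2: [z |-> |z|^2] has modulus 1. *)
Definition strongly_convex (F : R[i] -> R) (c : R) : Prop :=
  forall (t : R) (z w : R[i]), 0 <= t -> t <= 1 ->
    F ((1 - t)%:C * z + t%:C * w) <=
    (1 - t) * F z + t * F w - c * (t * (1 - t)) * rnorm (z - w) ^+ 2.

(** A strongly convex function grows at least quadratically away from a
minimizer. *)
Lemma strongly_convex_growth (F : R[i] -> R) (c : R) (z : R[i]) :
  strongly_convex F c -> 0 <= c -> (forall w, F z <= F w) ->
  forall w, F z + c * rnorm (z - w) ^+ 2 <= F w.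
Proof.
move=> Fc c0 Fz w; set q := c * rnorm (z - w) ^+ 2.
have q0 : 0 <= q by rewrite mulr_ge0 // sqr_ge0.
apply/ler_addgt0Pr => e e0.
(* This [t] plays the role of a small parameter: [t * q <= e], where [t * q] is
   what the strong-convexity inequality loses with respect to its limit as [t]
   tends to 0. *)
pose t := e / (e + q).
have eq0 : 0 < e + q by lra.
have t0 : 0 < t by rewrite divr_gt0.
have t1 : t <= 1 by rewrite ler_pdivrMr // mul1r; lra.
have tE : t * (e + q) = e by rewrite /t; field; lra.
have := le_trans (Fz _) (Fc t z w (ltW t0) t1).
have -> : c * (t * (1 - t)) * rnorm (z - w) ^+ 2 = t * ((1 - t) * q).
  by rewrite /q; ring.
clearbody q => h.
have : 0 <= t * (F w - F z - (1 - t) * q).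
  move: h; rewrite -subr_ge0; congr (_ <= _); ring.
rewrite pmulr_rge0 //.
have : t * q <= e by have : 0 <= t * e by [rewrite mulr_ge0 ?ltW]; lra.
lra.
Qed.

(** A form of Cauchy completeness.  [P d r] reads: [r] is an approximation with
error [d]; approximations that are pairwise compatible have a common target,
namely the supremum of the lower bounds [r - d]. *)
Lemma approx_point (P : R -> R -> Prop) :
  (exists d r, P d r) ->
  (forall d d' r r', P d r -> P d' r' -> r <= r' + (d + d')) ->
  exists a, forall d r, P d r -> `|r - a| <= d.
Proof.
move=> [d0 [r0 P0]] Pc.
pose E := [set s | exists d r, P d r /\ s = r - d].
have Eub d r : P d r -> ubound E (r + d).
  by move=> Pdr _ [d' [r' [P' ->]]]; have := Pc _ _ _ _ P' Pdr; lra.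
exists (sup E) => d r Pdr; rewrite ler_distl; apply/andP; split.
  by rewrite lerBlDr; apply: ge_sup; [exists (r0 - d0), d0, r0 | exact: Eub].
rewrite -lerBlDr; apply: ub_le_sup; first by exists (r0 + d0); exact: Eub.
by exists d, r.
Qed.

(** The last hypothesis is lower semicontinuity. *)
Lemma strongly_convex_minimizer (F : R[i] -> R) (c b : R) :
  strongly_convex F c -> 0 < c -> (forall z, b <= F z) ->
  (forall z e, 0 < e -> exists2 d, 0 < d &
     forall w, rnorm (z - w) <= d -> F z <= F w + e) ->
  exists z, forall w, F z <= F w.
Proof.
move=> Fc c0 Fb Fs.
set m := inf (range F).
have Flb : has_lbound (range F) by exists b => _ [z _ <-].
have mF w : m <= F w by apply: ge_inf => //; exists w.
(* By strong convexity at midpoints, any two points of these sublevel sets are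
   at distance at most the sum of their parameters ([Ldist]). *)
pose L d z := 0 < d /\ F z <= m + c / 4 * d ^+ 2.
have Lne d : 0 < d -> exists z, L d z.
  move=> d0; have e0 : 0 < c / 4 * d ^+ 2 by rewrite mulr_gt0 ?exprn_gt0 //; lra.
  have Finf : has_inf (range F) by split=> //; exists (F 0), 0.
  have [_ [z _ <-] hz] := inf_adherent e0 Finf.
  by exists z; split => //; exact: ltW.
have Ldist d d' z w : L d z -> L d' w -> rnorm (z - w) <= d + d'.
  move=> [d0 Fz] [d0' Fw].
  have h2 : (0 : R) <= 1/2 by lra.
  have h2' : (1/2 : R) <= 1 by lra.
  have := le_trans (mF _) (Fc (1/2) z w h2 h2') => h.
  rewrite -ler_sqr ?nnegrE ?rnorm_ge0 //; last by rewrite addr_ge0 ?ltW.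
  have : 0 <= c * ((d + d') ^+ 2 - rnorm (z - w) ^+ 2).
    have : 0 <= c * (d ^+ 2 + 4 * (d * d') + d' ^+ 2).
      by rewrite mulr_ge0 ?addr_ge0 ?sqr_ge0 ?mulr_ge0 ?ltW.
    lra.
  by rewrite pmulr_rge0 // subr_ge0.
have coord (u : R[i] -> R) : (forall z w, `|u z - u w| <= rnorm (z - w)) ->
    exists a, forall d z, L d z -> `|u z - a| <= d.
  move=> ulip.
  pose P d r := exists2 z, L d z & r = u z.
  have [||a ha] := approx_point P.
  - by have [z Lz] := Lne 1 ltr01; exists 1, (u z), z.
  - move=> d d' _ _ [z Lz ->] [w Lw ->].
    have := le_trans (ler_norm _) (le_trans (ulip z w) (Ldist _ _ _ _ Lz Lw)).
    lra.
  by exists a => d z Lz; apply: ha; exists z.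
have [|x hx] := coord (@complex.Re R).
  by move=> z w; rewrite -raddfB ler_Re_rnorm.
have [|y hy] := coord (@complex.Im R).
  by move=> z w; rewrite -raddfB ler_Im_rnorm.
exists (x +i* y) => w.
apply: le_trans (mF w); apply/ler_addgt0Pr => e e0.
have [|d d0 hd] := Fs (x +i* y) (e / 2); first by lra.
(* The bound [d / 2] brings each coordinate of a point of [L d'] within [d / 2]
   of the limit; the other two make [c / 4 * d' ^+ 2 <= e / 2]. *)
pose d' := Num.min (d / 2) (Num.min 1 (2 * e / c)).
have d'0 : 0 < d' by rewrite !lt_min ltr01 !divr_gt0 ?mulr_gt0.
have d'd : d' <= d / 2 by rewrite ge_min lexx.
have d'1 : d' <= 1 by rewrite !ge_min lexx orbT.
have d'e : d' <= 2 * e / c by rewrite !ge_min lexx !orbT.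
have [z Lz] := Lne d' d'0.
have /hd Fxy : rnorm ((x +i* y) - z) <= d.
  apply: le_trans (rnorm_le_ReIm _) _ => /=.
  have := hx _ _ Lz; have := hy _ _ Lz.
  rewrite distrC => h1; rewrite distrC => h2.
  case: z {Lz} h1 h2 => z1 z2 /= h1 h2; lra.
have {}d'e : c * d' <= 2 * e by move: d'e; rewrite ler_pdivlMr // mulrC.
have : c / 4 * d' ^+ 2 <= e / 2.
  have : c * d' * d' <= 2 * e * 1.
    by apply: ler_pM; rewrite ?mulr_ge0 ?(ltW c0) ?(ltW d'0).
  lra.
case: Lz => _; lra.
Qed.

End StronglyConvex.

(** * Operators on a Hilbert space *)

Section HilbertSpace.
Context {R : realType} {H : complexHilbertType R}.
Implicit Types (u v x : H).

Lemma rnorm_sqr_convex (t : R) u v :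
  rnorm ((1 - t)%:C *: u + t%:C *: v) ^+ 2 =
  (1 - t) * rnorm u ^+ 2 + t * rnorm v ^+ 2
    - t * (1 - t) * rnorm (u - v) ^+ 2.
Proof.
apply: (@complexI R).
transitivity (`|(1 - t)%:C *: u + t%:C *: v| ^+ 2).
  by rewrite -rnormE rmorphXn.
transitivity ((1 - t%:C) * `|u| ^+ 2 + t%:C * `|v| ^+ 2
    - t%:C * (1 - t%:C) * `|u - v| ^+ 2); last by rewrite -!rnormE; ring.
have conjC (s : R) : Num.conj s%:C = s%:C by exact: conjc_real.
rewrite !sqr_norm_inner !(linearDl, linearDr) !(linearNl, linearNr).
rewrite !(linearZl_LR, linearZr_LR) /= !conjC; ring.
Qed.

Lemma bounded_lin_comb (A B : H -> H) (a : R[i]) :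
  bounded_operator A -> bounded_operator B -> bounded_operator (A \+ a \*: B).
Proof.
move=> [M hM] [N hN]; exists (M + rnorm a * N) => x.
apply: le_trans (rnorm_triangle _ _) _.
rewrite /= rnormZ mulrDl lerD // -mulrA ler_wpM2l //; exact: rnorm_ge0.
Qed.

Lemma rnorm_le_opnorm (A : H -> H) x :
  bounded_operator A -> rnorm x <= 1 -> rnorm (A x) <= opnorm A.
Proof.
move=> [M hM] x1; apply: ub_le_sup; last by exists x.
exists `|M| => _ [y y1 <-]; apply: le_trans (hM y) _.
rewrite -[leRHS]mulr1; apply: le_trans (ler_norm _) _.
by rewrite normrM ler_wpM2l // ger0_norm // rnorm_ge0.
Qed.

Lemma minmod_le_rnorm (A : H -> H) x : rnorm x = 1 -> minmod A <= rnorm (A x).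
Proof.
move=> x1; apply: ge_inf; last by exists x.
by exists 0 => _ [y _ <-]; exact: rnorm_ge0.
Qed.

Lemma minmod_ge0 (A : H -> H) : 0 <= minmod A.
Proof.
have [[E0 _]|/inf_out Einf] := pselect (has_inf
    [set rnorm (A x) | x in [set x : H | rnorm x = 1]]); last by rewrite /minmod Einf.
by apply: lb_le_inf E0 _ => _ [x _ <-]; exact: rnorm_ge0.
Qed.

Lemma rnorm_normalize x : x != 0 -> rnorm ((rnorm x)^-1%:C *: x) = 1.
Proof.
move=> x0; rewrite rnormZ rnormRC ger0_norm ?invr_ge0 ?rnorm_ge0 // mulVf //.
by apply: contra_neq x0 => /rnorm_eq0.
Qed.

Lemma opnorm_ge0 (A : H -> H) : bounded_operator A -> 0 <= opnorm A.
Proof.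
move=> hA; apply: le_trans (@rnorm_le_opnorm A 0 hA _); first exact: rnorm_ge0.
by rewrite /rnorm normr0.
Qed.

(** The supremum defining [opnorm] ranges over the unit ball; for linear maps,
unit vectors suffice.  Nonnegativity of [M] covers the zero vector. *)
Lemma opnorm_le (A : {linear H -> H}) (M : R) : 0 <= M ->
  (forall x, rnorm x = 1 -> rnorm (A x) <= M) -> opnorm A <= M.
Proof.
move=> M0 hA; apply: ge_sup.
  by exists (rnorm (A 0)), 0 => //=; rewrite /rnorm normr0.
move=> _ [x /= x1 <-].
have [->|x0] := eqVneq x 0; first by rewrite linear0 /rnorm normr0.
have rx0 : 0 < rnorm x.
  rewrite lt_neqAle rnorm_ge0 andbT eq_sym.
  by apply: contra_neq x0 => /rnorm_eq0.
have -> : A x = (rnorm x)%:C *: A ((rnorm x)^-1%:C *: x).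
  rewrite linearZ scalerA -rmorphM /= mulfV ?scale1r //; exact: lt0r_neq0.
rewrite rnormZ rnormRC ger0_norm ?rnorm_ge0 //.
rewrite -[leRHS]mul1r ler_pM ?rnorm_ge0 // hA //; exact: rnorm_normalize.
Qed.

(** * The pencil T + z S *)

Section Pencil.
Variables (T S : {linear H -> H}).
Hypothesis H_neq0 : exists x : H, x != 0.
Hypothesis T_bounded : bounded_operator T.
Hypothesis S_bounded : bounded_operator S.

Lemma pencil_strongly_convex :
  strongly_convex (fun z => opnorm (T \+ z \*: S) ^+ 2) (minmod S ^+ 2).
Proof.
move=> t z w t0 t1.
set Q := (X in _ <= X).
have bd a := bounded_lin_comb _ _ a T_bounded S_bounded.
have hQ x : rnorm x = 1 ->
    rnorm ((T \+ ((1 - t)%:C * z + t%:C * w) \*: S) x) ^+ 2 <= Q.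
  move=> x1.
  have -> : (T \+ ((1 - t)%:C * z + t%:C * w) \*: S) x =
      (1 - t)%:C *: (T \+ z \*: S) x + t%:C *: (T \+ w \*: S) x.
    rewrite /= !scalerDr scalerDl !scalerA addrACA; congr (_ + _).
    by rewrite -scalerDl rmorphB rmorph1 subrK scale1r.
  have dE : (T \+ z \*: S) x - (T \+ w \*: S) x = (z - w) *: S x.
    by rewrite /= opprD addrACA subrr add0r scalerBl.
  rewrite rnorm_sqr_convex dE rnormZ.
  have pb a : rnorm ((T \+ a \*: S) x) ^+ 2 <= opnorm (T \+ a \*: S) ^+ 2.
    rewrite ler_sqr ?nnegrE ?rnorm_ge0 ?opnorm_ge0 //.
    by apply: rnorm_le_opnorm => //; rewrite x1.
  rewrite /Q lerB // ?lerD // ?ler_wpM2l ?subr_ge0 //.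
  have -> : minmod S ^+ 2 * (t * (1 - t)) * rnorm (z - w) ^+ 2 =
      t * (1 - t) * (rnorm (z - w) * minmod S) ^+ 2 by ring.
  apply: ler_wpM2l; first by rewrite mulr_ge0 // subr_ge0.
  rewrite ler_sqr ?nnegrE ?mulr_ge0 ?minmod_ge0 ?rnorm_ge0 //.
  by rewrite ler_wpM2l ?rnorm_ge0 // minmod_le_rnorm.
(* [Q] is nonnegative because it bounds a square at some unit vector. *)
have [x0 x0N] := H_neq0.
have Q0 : 0 <= Q.
  by apply: le_trans (hQ _ (rnorm_normalize _ x0N)); rewrite sqr_ge0.
rewrite -(sqr_sqrtr Q0) ler_sqr ?nnegrE ?sqrtr_ge0 ?opnorm_ge0 //.
apply: opnorm_le (sqrtr_ge0 Q) _ => x x1.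
rewrite -[leLHS]ger0_norm ?rnorm_ge0 // -sqrtr_sqr.
by apply: ler_wsqrtr; exact: hQ.
Qed.

Lemma pencil_opnorm_lipschitz (z w : R[i]) :
  opnorm (T \+ z \*: S) <= opnorm (T \+ w \*: S) + rnorm (z - w) * opnorm S.
Proof.
have bd := bounded_lin_comb _ _ w T_bounded S_bounded.
apply: opnorm_le => [|x x1].
  by rewrite addr_ge0 ?mulr_ge0 ?rnorm_ge0 ?opnorm_ge0.
have zE : T x + z *: S x = (T x + w *: S x) + (z - w) *: S x.
  by rewrite -addrA -scalerDl addrCA subrr addr0.
rewrite /= zE; apply: le_trans (rnorm_triangle _ _) _; rewrite rnormZ lerD //.
  by apply: (rnorm_le_opnorm (T \+ w \*: S)) => //; rewrite x1.
rewrite ler_wpM2l ?rnorm_ge0 //.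
by apply: rnorm_le_opnorm => //; rewrite x1.
Qed.

Lemma pencil_opnorm_lsc (z : R[i]) (e : R) : 0 < e ->
  exists2 d, 0 < d & forall w, rnorm (z - w) <= d ->
    opnorm (T \+ z \*: S) ^+ 2 <= opnorm (T \+ w \*: S) ^+ 2 + e.
Proof.
move=> e0.
have bd a := bounded_lin_comb _ _ a T_bounded S_bounded.
have K0 := opnorm_ge0 S S_bounded.
have p0 := opnorm_ge0 _ (bd z).
set K := opnorm S in K0; set p := opnorm (T \+ z \*: S) in p0 *.
have Kp : 0 <= K * p by rewrite mulr_ge0.
have D0 : 0 < 2 * (K * p) + 1 by lra.
pose d := e / (2 * (K * p) + 1).
have d0 : 0 < d by rewrite divr_gt0.
have dE : d * (2 * (K * p) + 1) = e by rewrite /d divfK // gt_eqF.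
(* From [p <= q + d K] one gets [p^2 <= q^2 + 2 (d K) p] whatever the sign of
   [p - d K], hence the choice of [d]. *)
exists d => // w hw.
have q0 := opnorm_ge0 _ (bd w).
have pq : p <= opnorm (T \+ w \*: S) + d * K.
  by apply: le_trans (pencil_opnorm_lipschitz z w) _; rewrite lerD2l ler_wpM2r.
move: q0 pq; set q := opnorm (T \+ w \*: S) => q0 pq.
have : 2 * (d * K) * p <= e by rewrite -dE; lra.
have dK : 0 <= d * K by rewrite mulr_ge0 // ltW.
have [pdK|dKp] := lerP p (d * K).
  have : 0 <= (d * K - p) * p by rewrite mulr_ge0 // subr_ge0.
  have := sqr_ge0 q; have := sqr_ge0 p; lra.
have : (p - d * K) ^+ 2 <= q ^+ 2.
  by rewrite ler_sqr ?nnegrE ?subr_ge0 ?(ltW dKp) // lerBlDr.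
have := sqr_ge0 (d * K); lra.
Qed.

End Pencil.

End HilbertSpace.

Theorem corollary2p11 (R : realType) (H : complexHilbertType R)
    (H_neq0 : exists x : H, x != 0)
    (T S : {linear H -> H})
    (T_bounded : bounded_operator T) (S_bounded : bounded_operator S)
    (minmod_S_gt0 : 0 < minmod S) :
  exists! gamma : R[i], forall lambda : R[i],
    opnorm ((T \+ (gamma \*: S)) \+ (lambda \*: S)) ^+ 2 >=
      opnorm (T \+ (gamma \*: S)) ^+ 2 + rnorm lambda ^+ 2 * minmod S ^+ 2.
Proof.
have pencilD (z w : R[i]) : (T \+ z \*: S) \+ w \*: S = T \+ (z + w) \*: S.
  by apply/funext => x /=; rewrite scalerDl addrA.
have F0 z : 0 <= opnorm (T \+ z \*: S) ^+ 2 by rewrite sqr_ge0.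
have Fc := pencil_strongly_convex T S H_neq0 T_bounded S_bounded.
have m0 : 0 < minmod S ^+ 2 by rewrite exprn_gt0.
have [z zmin] := strongly_convex_minimizer _ _ _ Fc m0 F0
  (pencil_opnorm_lsc T S T_bounded S_bounded).
exists z; split=> [lambda|w wP].
  rewrite pencilD mulrC.
  have := strongly_convex_growth _ _ _ Fc (ltW m0) zmin (z + lambda).
  by rewrite opprD addrA subrr add0r /rnorm normrN.
have := wP (z - w); rewrite pencilD addrCA subrr addr0 => h.
have : rnorm (z - w) ^+ 2 * minmod S ^+ 2 <= 0 by have := zmin w; lra.
rewrite pmulr_lle0 // => h2.
have : rnorm (z - w) ^+ 2 == 0 by rewrite eq_le h2 sqr_ge0.
by rewrite sqrf_eq0 => /eqP/rnorm_eq0/eqP; rewrite subr_eq0 => /eqP.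
Qed.
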